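(* Let $0<\alpha<1$. For each integer $N\ge 1$ let $Z_{N,\frac{\alpha}{N}}$ be a random variable with the Abelian distribution with parameters $N$ and $p=\frac{\alpha}{N}$. Then $$\lim_{N\to+\infty} V\left(Z_{N,\frac{\alpha}{N}}\right)=\frac{\alpha}{(1-\alpha)^{3}}.$$
   Context: For an integer $N\ge 1$ and $p\in(0,\frac1N)$, the Abelian distribution with parameters $N,p$ is the probability distribution on $\{1,2,\dots,N\}$ given by $$P(Z_{N,p} = b)= C_{N,p}\binom{N-1}{b-1}p^{b-1}(1-bp)^{N-b-1}b^{b-2},\qquad b=1,\dots,N,$$ where $C_{N,p}= \frac{1-Np}{1-(N-1)p}$ is the normalization constant. (It is known that these values sum to $1$.) $V$ denotes variance. *)

(* Defs.v *)
From mathcomp Require Import all_boot all_order all_algebra.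
From mathcomp Require Import all_classical all_reals all_analysis.

Set Implicit Arguments.
Unset Strict Implicit.
Unset Printing Implicit Defensive.

Import Order.TTheory GRing.Theory Num.Theory.
Import numFieldNormedType.Exports.

Local Open Scope classical_set_scope.
Local Open Scope ring_scope.

Definition abelian_const (R : realType) (N : nat) (p : R) : R :=
  (1 - N%:R * p) / (1 - (N%:R - 1) * p).

(* The last two exponents are integers: [N - b - 1] is [-1] at [b = N] and
   [b - 2] is [-1] at [b = 1]. The other subtractions are on [nat] and do not
   truncate for [1 <= b <= N]. *)
Definition abelian_pmf (R : realType) (N : nat) (p : R) (b : nat) : R :=
  abelian_const N p * 'C(N - 1, b - 1)%:R * p ^+ (b - 1)
    * (1 - b%:R * p) ^ (N%:Z - b%:Z - 1) * b%:R ^ (b%:Z - 2).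

Definition has_abelian_distribution (d : measure_display)
    (T : measurableType d) (R : realType) (P : probability T R)
    (Z : {RV P >-> R}) (N : nat) (p : R) : Prop :=
  distribution P Z [set b%:R | b in [set b : nat | (1 <= b <= N)%N]] = 1%E /\
  forall b : nat, (1 <= b <= N)%N ->
    distribution P Z [set b%:R] = (abelian_pmf N p b)%:E.

(* Main.v *)
Require Import Defs.
From mathcomp Require Import all_boot all_order all_algebra.
From mathcomp Require Import all_classical all_reals all_analysis.
From mathcomp Require Import measurable_realfun.
From mathcomp Require Import ring lra zify.
Import Order.TTheory GRing.Theory Num.Theory.
Import numFieldNormedType.Exports.
Local Open Scope classical_set_scope.
Local Open Scope ring_scope.

Set Implicit Arguments.
Unset Strict Implicit.
Unset Printing Implicit Defensive.

(** The first two moments of an Abelian variable have closed forms, and their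
    limits give the limit of the variance.

    Put [n = N - 1] and [b = k + 1]. The factor [b ^ (b - 2)] becomes harmless
    once it is multiplied by [b]: the sums of [f b * b * P(Z = b)] are, up to
    the constant [abelian_const], Abel type sums
      [sum_k f(x + k) C(n,k) ((x+k)p)^k (1 - (x+k)p)^(n-k) / (1 - (x+k)p)]
    at [x = 1]. For [f = 1] (the mean) such a sum is one of Abel's binomial
    identities, with value [1 / (1 - (x+n)p)] ([abel_sum_inv_onem]). For
    [f = id] (the second moment) splitting the factor [x + k] gives a
    recurrence in [n], which unrolls to a sum of falling factorials
    ([abel_sum_id_div_onem]). With [c = 1 / (1 - (N-1)p)] this reads
      [E Z = c] and [E Z^2 = c * M_1], where
      [M_m = sum_j (1+j)^m (N-1)(N-2)...(N-j) p^j],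
    hence [V Z = c M_1 - c^2] ([variance_abelian]).

    For [p = alpha / N], [c] tends to [1 / (1 - alpha)]. The summand
    [t_j = (N-1)...(N-j) p^j] tends to [alpha^j], and the expected limit of
    [M_1] is [sum_j (1+j) alpha^j = 1 / (1-alpha)^2]. Rather than exchanging
    limit and sum, one uses [alpha t_j - t_(j+1) = p (1+j) t_j]: summed against
    powers of [j] it gives linear relations between the [M_m]
    ([ffact_moment_rec]), whose error terms carry a factor [p]. They yield
    [1 - 3 p / (1-alpha)^2 <= (1-alpha)^2 M_1 <= 1]
    ([ffact_moment1_bounds]). The limit of the variance is therefore
    [1 / (1-alpha)^3 - 1 / (1-alpha)^2 = alpha / (1-alpha)^3]. *)

(** * Abel type binomial sums *)

Definition abel_term (R : realFieldType) (p : R) n (x : R) k : R :=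
  'C(n, k)%:R * ((x + k%:R) * p) ^+ k * (1 - (x + k%:R) * p) ^+ (n - k).

(** The sums [abel_sum p f n x] with [f u] equal to [1], [1 / (1 - u p)] and
    [u / (1 - u p)] are Abel's sums of [(x+k)^(k+r) (y+n-k)^(n-k+s)], rescaled
    by [p = 1 / (x+y+n)], with [(r, s)] equal to [(0, 0)], [(0, -1)] and
    [(1, -1)]. Keeping the exponents natural and putting the negative powers
    into [f] makes the recurrences below polynomial identities. *)
Definition abel_sum (R : realFieldType) (p : R) (f : R -> R) n (x : R) : R :=
  \sum_(k < n.+1) f (x + k%:R) * abel_term p n x k.

(** Split the factor [u = x + k] into [x] and [k]; the second part is absorbed
    by [k C(n+1,k) = (n+1) C(n,k-1)], which shifts [x] by one. *)
Lemma abel_sum_mulr (R : realFieldType) (p : R) (f : R -> R) n (x : R) :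
  abel_sum p (fun u => u * f u) n.+1 x =
  x * abel_sum p f n.+1 x +
  n.+1%:R * p * abel_sum p (fun u => u * f u) n (x + 1).
Proof.
rewrite /abel_sum !mulr_sumr.
rewrite (eq_bigr (fun k : 'I_n.+2 => x * (f (x + k%:R) * abel_term p n.+1 x k) +
   k%:R * (f (x + k%:R) * abel_term p n.+1 x k))); last by move=> k _; ring.
rewrite big_split; congr (_ + _) => /=.
rewrite big_ord_recl mul0r add0r; apply: eq_bigr => k _.
rewrite /abel_term lift0 subSS.
have -> : x + 1 + k%:R = x + k.+1%:R by rewrite -natr1; ring.
have -> : k.+1%:R * (f (x + k.+1%:R) * ('C(n.+1, k.+1)%:R *
    ((x + k.+1%:R) * p) ^+ k.+1 * (1 - (x + k.+1%:R) * p) ^+ (n - k))) =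
  (k.+1 * 'C(n.+1, k.+1))%:R * (f (x + k.+1%:R) *
    ((x + k.+1%:R) * p) ^+ k.+1 * (1 - (x + k.+1%:R) * p) ^+ (n - k)).
  by rewrite natrM; ring.
by rewrite -mul_bin_diag natrM exprS; ring.
Qed.

(** Same idea as [abel_sum_mulr] for the other factor: here
    [1 - (x+k)p = (1 - (x+n+1)p) + (n+1-k)p] and
    [(n+1-k) C(n+1,k) = (n+1) C(n,k)], so that [x] stays in place. *)
Lemma abel_sum_mul_onem (R : realFieldType) (p : R) (f : R -> R) n (x : R) :
  abel_sum p (fun u => f u * (1 - u * p)) n.+1 x =
  (1 - (x + n.+1%:R) * p) * abel_sum p f n.+1 x +
  n.+1%:R * p * abel_sum p (fun u => f u * (1 - u * p)) n x.
Proof.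
rewrite /abel_sum !mulr_sumr.
rewrite (eq_bigr (fun k : 'I_n.+2 =>
   (1 - (x + n.+1%:R) * p) * (f (x + k%:R) * abel_term p n.+1 x k) +
   (n.+1 - k)%:R * p * (f (x + k%:R) * abel_term p n.+1 x k))); last first.
  by move=> k _; rewrite natrB ?leq_ord//; ring.
rewrite big_split; congr (_ + _) => /=.
rewrite big_ord_recr subnn /= !mul0r addr0; apply: eq_bigr => k _.
rewrite /abel_term subSn ?leq_ord//.
have -> : ((n - k).+1%:R * p * (f (x + k%:R) * ('C(n.+1, k)%:R *
    ((x + k%:R) * p) ^+ k * (1 - (x + k%:R) * p) ^+ (n - k).+1))) =
  ((n.+1 - k) * 'C(n.+1, k))%:R * p * (f (x + k%:R) *
    ((x + k%:R) * p) ^+ k * (1 - (x + k%:R) * p) ^+ (n - k).+1).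
  by rewrite natrM subSn ?leq_ord//; ring.
by rewrite -mul_bin_down natrM exprS; ring.
Qed.

Lemma onem_shift_gt0 (R : realFieldType) (p x : R) n (k : 'I_n.+1) :
  0 < p -> (x + n%:R) * p < 1 -> 0 < 1 - (x + k%:R) * p.
Proof.
move=> p0 h; rewrite subr_gt0 (le_lt_trans _ h)// ler_pM2r// lerD2l ler_nat.
exact: leq_ord.
Qed.

Lemma abel_sum_ext (R : realFieldType) (p : R) (f g : R -> R) n (x : R) :
  0 < p -> (x + n%:R) * p < 1 ->
  (forall u, 0 < 1 - u * p -> f u = g u) -> abel_sum p f n x = abel_sum p g n x.
Proof.
move=> p0 h fg; apply: eq_bigr => k _; congr (_ * _); apply: fg.
exact: onem_shift_gt0.
Qed.

(** The second equality is Abel's identity. The first one, independence of [x],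
    is what makes the induction work. Write [D], [A], [B] for the sums with
    [f u] equal to [1], [1 / (1 - u p)], [u / (1 - u p)], so that [A = p B + D].
    With [abel_sum_mulr] and [abel_sum_mul_onem] this gives
      [A (n+1) x = p B n (x+1) + D n x = A n (x+1) + (D n x - D n (x+1))],
    whose last difference vanishes by induction, and then
      [D (n+1) x = (1 - (x+n+1)p) A (n+1) x + (n+1) p D n x]
    is again independent of [x]. *)
Lemma abel_sum_inv_onem (R : realFieldType) (p : R) n : 0 < p ->
  exists d, forall x, (x + n%:R) * p < 1 ->
    abel_sum p (fun=> 1) n x = d /\
    abel_sum p (fun u => (1 - u * p)^-1) n x = (1 - (x + n%:R) * p)^-1.
Proof.
move=> p0; elim: n => [|n [d IHn]].
  exists 1 => x _; rewrite /abel_sum !big_ord1 /abel_term bin0 subn0 !expr0.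
  by rewrite !mulr1.
exists (1 + n.+1%:R * p * d) => x xn.
have xn1 : (x + 1 + n%:R) * p < 1.
  by move: xn; rewrite -natr1; congr (_ < _); ring.
have xn0 : (x + n%:R) * p < 1.
  by apply: le_lt_trans xn; rewrite ler_pM2r// lerD2l ler_nat.
have nz : (1 - (x + n.+1%:R) * p) != 0 by rewrite gt_eqF// subr_gt0.
have [Dx _] := IHn _ xn0; have [Dx1 Ax1] := IHn _ xn1.
set f := fun u : R => (1 - u * p)^-1.
have Af : forall y m, (y + m%:R) * p < 1 ->
    abel_sum p f m y =
    p * abel_sum p (fun u => u * f u) m y + abel_sum p (fun=> 1) m y.
  move=> y m ym; rewrite /abel_sum mulr_sumr -big_split.
  apply: eq_bigr => k _ /=.
  have /gt_eqF := onem_shift_gt0 k p0 ym.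
  by rewrite /f; move=> kp; field; rewrite kp.
have ff m y : (y + m%:R) * p < 1 ->
    abel_sum p (fun u => f u * (1 - u * p)) m y = abel_sum p (fun=> 1) m y.
  move=> ym; apply: abel_sum_ext => // u u0.
  by rewrite mulVf// gt_eqF.
have := abel_sum_mul_onem p f n x; rewrite !ff// Dx => Rdown.
have := abel_sum_mulr p f n x => Rup.
have A1 := Af _ _ xn1; rewrite Dx1 Ax1 in A1.
have A := Af _ _ xn.
have AE : abel_sum p f n.+1 x = (1 - (x + n.+1%:R) * p)^-1.
  (* Eliminating the sum D (n+1) x between its two expressions leaves the
     equation for A multiplied by (n+1) p. *)
  have np : n.+1%:R * p != 0 by rewrite mulf_neq0 ?pnatr_eq0// gt_eqF.
  apply: (mulfI np).
  have -> : 1 - (x + n.+1%:R) * p = 1 - (x + 1 + n%:R) * p.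
    by rewrite -natr1; ring.
  rewrite A1; move: A Rdown; rewrite Rup => A Rdown.
  by move: A Rdown; rewrite -!natr1; lra.
split; last exact: AE.
by rewrite Rdown AE mulfV.
Qed.

(** Unrolling [abel_sum_mulr]: each step contributes Abel's identity at a pair
    [(x + j, n - j)], so all steps share the denominator [1 - (x+n)p]. *)
Lemma abel_sum_id_div_onem (R : realFieldType) (p : R) n x : 0 < p ->
  (x + n%:R) * p < 1 ->
  abel_sum p (fun u => u * (1 - u * p)^-1) n x =
  (\sum_(j < n.+1) (x + j%:R) * (n ^_ j)%:R * p ^+ j) / (1 - (x + n%:R) * p).
Proof.
move=> p0; elim: n x => [|n IHn] x xn.
  rewrite /abel_sum !big_ord1 /abel_term bin0 ffactn0 subn0 !expr0.
  by rewrite !mulr1.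
have xn1 : (x + 1 + n%:R) * p < 1.
  by move: xn; rewrite -natr1; congr (_ < _); ring.
rewrite abel_sum_mulr IHn//.
have [d /(_ _ xn)[_ ->]] := abel_sum_inv_onem n.+1 p0.
have <- : 1 - (x + n.+1%:R) * p = 1 - (x + 1 + n%:R) * p.
  by rewrite -natr1; ring.
rewrite mulrA -mulrDl; congr (_ / _).
rewrite [in RHS]big_ord_recl /= ffactn0 expr0 addr0 !mulr1; congr (_ + _).
rewrite mulr_sumr; apply: eq_bigr => j _.
by rewrite /bump add1n ffactnS /= natrM -natr1 exprS; ring.
Qed.

(** * Moments of the falling factorial weights *)

(** With [n = N - 1] and [p = alpha / N], the weight of [j] is close to
    [alpha ^ j], and this sum to that of [(1+j)^m alpha^j]. *)
Definition ffact_moment (R : realFieldType) (p : R) n m : R :=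
  \sum_(j < n.+1) (1 + j%:R) ^+ m * ((n ^_ j)%:R * p ^+ j).

(** The weights [t_j = n^_j p^j] satisfy [t_(j+1) = (n-j) p t_j], that is
    [(n+1) p t_j = t_(j+1) + p (1+j) t_j]; the sum of [h (j+1) t_(j+1)] is the
    sum of [h j t_j] without its first term, because [t_(n+1) = 0]. *)
Lemma ffact_sum_telescope (R : realFieldType) (p : R) n (h : nat -> R) :
  n.+1%:R * p * (\sum_(j < n.+1) h j.+1 * ((n ^_ j)%:R * p ^+ j)) =
  \sum_(j < n.+1) h j * ((n ^_ j)%:R * p ^+ j) - h 0%N +
  p * \sum_(j < n.+1) h j.+1 * (1 + j%:R) * ((n ^_ j)%:R * p ^+ j).
Proof.
have -> : \sum_(j < n.+1) h j * ((n ^_ j)%:R * p ^+ j) - h 0%N =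
   \sum_(j < n.+1) h j.+1 * ((n ^_ j.+1)%:R * p ^+ j.+1).
  rewrite big_ord_recl ffactn0 expr0 !mulr1 addrC addKr.
  rewrite [RHS]big_ord_recr /= (@ffact_small n n.+1)// mul0r mulr0 addr0.
  by [].
rewrite !mulr_sumr -big_split; apply: eq_bigr => j _ /=.
rewrite ffactnSr natrM natrB ?leq_ord// -natr1 exprS; ring.
Qed.

Lemma ffact_moment_ge0 (R : realFieldType) (p : R) n m :
  0 <= p -> 0 <= ffact_moment p n m.
Proof.
by move=> p0; apply: sumr_ge0 => j _; rewrite !mulr_ge0// exprn_ge0// addr_ge0.
Qed.

(** These are [ffact_sum_telescope] for [h j] equal to [1], [j] and [j ^ 2].
    Dropping the terms with a factor [p] leaves the relations between the sums
    of [(1+j)^m a^j] over all [j]. *)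
Lemma ffact_moment_rec (R : realFieldType) (p : R) n (a := n.+1%:R * p) :
  [/\ (1 - a) * ffact_moment p n 0 = 1 - p * ffact_moment p n 1,
      (1 - a) * ffact_moment p n 1 =
        ffact_moment p n 0 - p * ffact_moment p n 2 &
      (1 - a) * ffact_moment p n 2 =
        2 * ffact_moment p n 1 - ffact_moment p n 0 - p * ffact_moment p n 3].
Proof.
have T h M0 M1 M2 :
    M0 = \sum_(j < n.+1) h j.+1 * ((n ^_ j)%:R * p ^+ j) ->
    M1 = \sum_(j < n.+1) h j * ((n ^_ j)%:R * p ^+ j) ->
    M2 = \sum_(j < n.+1) h j.+1 * (1 + j%:R) * ((n ^_ j)%:R * p ^+ j) ->
    (1 - a) * M0 = M0 - M1 + h 0%N - p * M2.
  by move=> -> -> ->; rewrite mulrBl /a ffact_sum_telescope; ring.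
split.
- rewrite (T (fun=> 1) (ffact_moment p n 0) (ffact_moment p n 0)
    (ffact_moment p n 1)).
  + by ring.
  + by apply: eq_bigr => j _.
  + by apply: eq_bigr => j _.
  + by apply: eq_bigr => j _; ring.
- rewrite (T (fun j => j%:R) (ffact_moment p n 1)
    (ffact_moment p n 1 - ffact_moment p n 0) (ffact_moment p n 2)).
  + by ring.
  + by apply: eq_bigr => j _; rewrite -natr1; ring.
  + by rewrite -sumrB; apply: eq_bigr => j _; ring.
  + by apply: eq_bigr => j _; rewrite -natr1; ring.
- rewrite (T (fun j => j%:R ^+ 2) (ffact_moment p n 2)
    (ffact_moment p n 2 - 2 * ffact_moment p n 1 + ffact_moment p n 0)
    (ffact_moment p n 3)).
  + by ring.
  + by apply: eq_bigr => j _; rewrite -natr1; ring.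
  + by rewrite mulr_sumr -sumrB -big_split; apply: eq_bigr => j _ /=; ring.
  + by apply: eq_bigr => j _; rewrite -natr1; ring.
Qed.

(** The first two relations of [ffact_moment_rec] give
    [(1-a)^2 M_1 = 1 - p M_1 - (1-a) p M_2]. The upper bound follows, and then
    the lower one: [M_1 <= (1-a)^-2], and [(1-a) M_2 <= 2 M_1] by the third
    relation, in which [M_0] and [M_3] enter with a favourable sign. This sign
    is why the relations, each involving the next moment, suffice. *)
Lemma ffact_moment1_bounds (R : realFieldType) (p a : R) n :
  0 <= p -> n.+1%:R * p = a -> a < 1 ->
  1 - 3 * p / (1 - a) ^+ 2 <= (1 - a) ^+ 2 * ffact_moment p n 1 <= 1.
Proof.
move=> p0 ap a1; have [] := ffact_moment_rec p n; rewrite ap.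
have a0 : 0 <= a by rewrite -ap mulr_ge0.
have := ffact_moment_ge0 n 0 p0; have := ffact_moment_ge0 n 1 p0.
have := ffact_moment_ge0 n 2 p0; have := ffact_moment_ge0 n 3 p0.
move: (ffact_moment p n 3) (ffact_moment p n 2).
move: (ffact_moment p n 1) (ffact_moment p n 0).
move=> M1 M0 M3 M2 M3_ge0 M2_ge0 M1_ge0 M0_ge0 E0 E1 E2.
set r := 1 - a in E0 E1 E2 *; have r0 : 0 < r by rewrite subr_gt0.
have p3 := mulr_ge0 p0 M3_ge0; have p2 := mulr_ge0 p0 M2_ge0.
have p1 := mulr_ge0 p0 M1_ge0.
have E : r ^+ 2 * M1 = 1 - p * M1 - r * (p * M2).
  by rewrite expr2 -mulrA E1 mulrBr E0.
have le1 : r ^+ 2 * M1 <= 1.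
  by rewrite E; have := mulr_ge0 (ltW r0) p2; lra.
rewrite le1 andbT -(ler_pM2l (exprn_gt0 2 r0)).
have -> : r ^+ 2 * (1 - 3 * p / r ^+ 2) = r ^+ 2 - 3 * p.
  by field; rewrite gt_eqF.
rewrite {1}E.
have rM2 : r * M2 <= 2 * M1 by lra.
have := ler_wpM2l p0 (ler_wpM2l (exprn_ge0 2 (ltW r0)) rM2).
have := ler_wpM2l p0 le1.
rewrite !mulrBr; lra.
Qed.

(** * Moments of variables supported by finitely many naturals *)

Lemma integral_natural_support (d : measure_display) (T : measurableType d)
    (R : realType) (P : probability T R) (Z : {RV P >-> R}) (s : seq nat)
    (f : R -> R) :
  measurable_fun setT f -> uniq s ->
  distribution P Z [set b%:R | b in [set` s]] = 1%E ->
  (\int[P]_w (f (Z w))%:E =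
   \sum_(b <- s) (f b%:R)%:E * distribution P Z [set b%:R])%E.
Proof.
move=> mf us hZ.
set F := fun b : nat => Z @^-1` [set b%:R : R].
have mF b : measurable (F b) by rewrite -[F b]setTI; exact: measurable_funP.
set D := \big[setU/set0]_(b <- s) F b.
have mD : measurable D by apply: bigsetU_measurable.
have PD : P D = 1%E.
  rewrite -hZ /distribution /pushforward /D -bigcup_seq; congr (P _).
  apply/seteqP; split=> [w [b bs Fb]|w [b bs Zb]].
    by exists b.
  by exists b.
have PDC : P (~` D) = 0%E by rewrite probability_setC// PD subee.
have mfZ A : measurable_fun A (fun w => f (Z w)).
  by apply: measurable_funTS; exact: measurableT_comp.
have mEfZ A : measurable_fun A (EFin \o (fun w => f (Z w)) : T -> \bar R).
  by apply/measurable_EFinP.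
(* Over a null set any measurable function has integral 0, so the integral
   can be split along D without f o Z being known to be integrable. *)
rewrite -(setUv D) integral_setU//=; last 2 first.
  by apply: measurableC.
  by apply/disj_setPS => w [].
rewrite [X in (_ + X)%E]null_set_integral ?adde0//; last first.
  by apply: measurableC.
rewrite integral_bigsetU_EFin//.
  apply: eq_big_seq => b bs.
  rewrite (eq_integral (cst (f b%:R)%:E)).
    by rewrite integral_cst.
  by move=> w; rewrite inE /F /preimage /= => ->.
apply/trivIsetP => i j _ _ ij.
apply/seteqP; split => // w [Zi Zj]; have : i%:R = j%:R :> R by rewrite -Zi -Zj.
by move=> /eqP; rewrite eqr_nat (negPf ij).
Qed.

(** The variance is the integral of a single function of [Z], the square of
    [u - m], so that [integral_natural_support] applies to it directly,
    before the first two moments are known to be finite. *)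
Lemma variance_natural_support (d : measure_display) (T : measurableType d)
    (R : realType) (P : probability T R) (Z : {RV P >-> R}) (s : seq nat)
    (q : nat -> R) :
  uniq s -> distribution P Z [set b%:R | b in [set` s]] = 1%E ->
  (forall b, b \in s -> distribution P Z [set b%:R] = (q b)%:E) ->
  'V_P[Z] =
  (\sum_(b <- s) b%:R ^+ 2 * q b - (\sum_(b <- s) b%:R * q b) ^+ 2)%:E.
Proof.
move=> us hs hq.
have I f : measurable_fun setT f ->
    (\int[P]_w (f (Z w))%:E = (\sum_(b <- s) f b%:R * q b)%:E)%E.
  move=> mf; rewrite (integral_natural_support mf us hs) -sumEFin.
  by apply: eq_big_seq => b bs; rewrite hq// EFinM.
have EZ : ('E_P[Z] = (\sum_(b <- s) b%:R * q b)%:E)%E.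
  by rewrite expectation_def (I id).
have q1 : \sum_(b <- s) q b = 1.
  apply: EFin_inj; have := I (cst 1) (measurable_cst _).
  under [in RHS]eq_bigr do rewrite mul1r.
  by move=> <-; rewrite -[RHS](expectation_cst P 1) expectation.unlock.
rewrite /variance covariance.unlock EZ /=.
move: EZ; set m := \sum_(b <- s) b%:R * q b => EZ.
rewrite expectation.unlock.
transitivity (\int[P]_w (((Z w - m) ^+ 2)%:E))%E.
  by apply: eq_integral => w _; rewrite expr2.
rewrite (I (fun u => (u - m) ^+ 2)); last first.
  by apply: measurable_funX; apply: measurable_funB.
congr EFin.
rewrite (eq_bigr (fun b : nat =>
  (b%:R ^+ 2 * q b - 2 * m * (b%:R * q b)) + m ^+ 2 * q b)); last first.
  by move=> b _; ring.
by rewrite big_split /= sumrB -!mulr_sumr q1 -/m; ring.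
Qed.

(** * The Abelian distribution *)

(** The factor [b] turns the exponent [b - 2] of the mass function into
    [b - 1], so that with [b = k + 1] the sum is an Abel sum at [x = 1]; the
    exponent [N - b - 1 = n - k - 1] accounts for the inverse of [1 - u p]. *)
Lemma sum_abelian_pmf (R : realType) (p : R) (n : nat) (f : R -> R) :
  0 < p -> n.+1%:R * p < 1 ->
  \sum_(1 <= b < n.+2) f b%:R * (b%:R * abelian_pmf n.+1 p b) =
  abelian_const n.+1 p * abel_sum p (fun u => f u * (1 - u * p)^-1) n 1.
Proof.
move=> p0 np; rewrite big_add1 big_mkord /= /abel_sum mulr_sumr.
apply: eq_bigr => k _.
rewrite /abelian_pmf /abel_term !subn1 /= nat1r.
have kp : 0 < 1 - k.+1%:R * p.
  rewrite subr_gt0 (le_lt_trans _ np)// ler_pM2r// ler_nat.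
  exact: ltn_ord.
have -> : (n.+1%:Z - k.+1%:Z - 1 = (n - k)%N%:Z - 1)%R.
  by have := leq_ord k; lia.
have -> : (k.+1%:Z - 2 = k%:Z - 1)%R by lia.
rewrite !expfzDr ?pnatr_eq0// ?gt_eqF// -!exprnP !exprN1 exprMn.
have u0 : 0 < k.+1%:R :> R by [].
move: (k.+1%:R) u0 kp => u u0 kp.
by field; rewrite !gt_eqF.
Qed.

(** The constant [(1 - N p) / (1 - (N-1) p)] of the distribution cancels the
    denominator [1 - N p] common to both Abel sums. *)
Lemma variance_abelian (d : measure_display) (T : measurableType d)
    (R : realType) (P : probability T R) (Z : {RV P >-> R}) (n : nat) (p : R) :
  0 < p -> n.+1%:R * p < 1 -> has_abelian_distribution Z n.+1 p ->
  'V_P[Z] = (ffact_moment p n 1 / (1 - n%:R * p) - (1 - n%:R * p)^-1 ^+ 2)%:E.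
Proof.
move=> p0 np [hs hq].
have np' : (1 + n%:R) * p < 1 by rewrite nat1r.
have np0 : 0 < 1 - n%:R * p.
  by rewrite subr_gt0 (lt_trans _ np)// ltr_pM2r// ltr_nat.
have np1 : 0 < 1 - (1 + n%:R) * p by rewrite subr_gt0.
have sE : [set b | (1 <= b <= n.+1)%N] = [set` index_iota 1 n.+2].
  by apply/seteqP; split => b /=; rewrite mem_index_iota ltnS.
rewrite sE in hs.
rewrite (variance_natural_support (s := index_iota 1 n.+2)
  (q := abelian_pmf n.+1 p) (iota_uniq _ _) hs); last first.
  by move=> b; rewrite mem_index_iota ltnS; exact: hq.
congr (_ - _ ^+ 2)%:E.
  under eq_bigr do rewrite expr2 -mulrA.
  rewrite (sum_abelian_pmf id p0 np) abel_sum_id_div_onem//.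
  rewrite /ffact_moment /abelian_const.
  under eq_bigr do rewrite -mulrA.
  under [in RHS]eq_bigr do rewrite expr1.
  by rewrite -!nat1r addrAC subrr add0r; field; rewrite !gt_eqF.
under eq_bigr do rewrite -[_ * _]mul1r.
rewrite (sum_abelian_pmf (fun=> 1) p0 np).
rewrite (@abel_sum_ext _ _ _ (fun u => (1 - u * p)^-1))//; last first.
  by move=> u _; rewrite mul1r.
have [_ /(_ _ np')[_ ->]] := abel_sum_inv_onem n p0.
by rewrite /abelian_const -!nat1r addrAC subrr add0r; field; rewrite !gt_eqF.
Qed.

Theorem theorem4p1 (R : realType) (alpha : R) (halpha : 0 < alpha < 1)
    (d : nat -> measure_display) (T : forall N : nat, measurableType (d N))
    (P : forall N : nat, probability (T N) R)
    (Z : forall N : nat, {RV (P N) >-> R})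
    (hZ : forall N : nat, (1 <= N)%N ->
       has_abelian_distribution (Z N) N (alpha / N%:R)) :
  'V_(P N)[Z N] @[N --> \oo] --> (alpha / (1 - alpha) ^+ 3)%:E.
Proof.
have /andP[a0 a1] := halpha.
have r0 : 0 < 1 - alpha by rewrite subr_gt0.
have rn0 : 1 - alpha != 0 by rewrite gt_eqF.
pose p n : R := alpha / n.+1%:R.
have p0 n : 0 < p n by rewrite divr_gt0.
have np n : n.+1%:R * p n = alpha by rewrite /p mulrC divfK// pnatr_eq0.
(* The index n stands for N - 1 from here on. *)
rewrite -cvg_shiftS.
rewrite (_ : (fun n => _) = fun n => (ffact_moment (p n) n 1 / (1 - n%:R * p n)
   - (1 - n%:R * p n)^-1 ^+ 2)%:E); last first.
  apply/funext => n; apply: variance_abelian => //; first by rewrite np.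
  exact: hZ.
apply: cvg_EFin; first by near=> n.
have p_cvg : p n @[n --> \oo] --> (0 : R).
  rewrite -(mulr0 alpha); apply: cvgMl_tmp; exact: cvg_harmonic.
have c_cvg : (1 - n%:R * p n)^-1 @[n --> \oo] --> (1 - alpha)^-1.
  apply: cvgV => //.
  rewrite (_ : (fun n => _) = fun n => 1 - alpha + p n); last first.
    by apply/funext => n; rewrite -{1}(np n) -natr1; ring.
  by rewrite -[X in _ --> X]addr0; apply: cvgD => //; exact: cvg_cst.
have M_cvg : ffact_moment (p n) n 1 @[n --> \oo] --> (1 - alpha) ^- 2.
  rewrite (_ : (fun n => _) = fun n => (1 - alpha) ^- 2 *
      ((1 - alpha) ^+ 2 * ffact_moment (p n) n 1)); last first.
    by apply/funext => n; rewrite mulKf// expf_neq0.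
  rewrite -[X in _ --> X]mulr1; apply: cvgMl_tmp.
  apply: (@squeeze_cvgr _ _ _ _
    (fun n => 1 - 3 * p n / (1 - alpha) ^+ 2) (fun=> 1)).
  - by near=> n; apply: ffact_moment1_bounds => //; exact: ltW.
  - rewrite -[X in _ --> X]subr0; apply: cvgB; first exact: cvg_cst.
    rewrite -(mul0r ((1 - alpha) ^- 2)); apply: cvgMr_tmp.
    by rewrite -(mulr0 3); apply: cvgMl_tmp.
  - exact: cvg_cst.
rewrite (_ : alpha / _ =
  (1 - alpha) ^- 2 / (1 - alpha) - (1 - alpha)^-1 ^+ 2); last first.
  by field.
by apply: cvgB; [apply: cvgM | rewrite !expr2; apply: cvgM].
Unshelve. all: by end_near.
Qed.
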